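(* Let $t_1,t_2$ be two transactions, let $\mathcal{O}$ be a set of $n$ observers, let $0\le m\le n$ be an integer, and let $E$ denote the event that exactly $m$ out of the $n$ observers receive $t_1$ before $t_2$. Assume $\Pr[E]>0$. Then the probability that $t_1$ has been sent before $t_2$, given that $m$ out of $n$ observers received $t_1$ before $t_2$, is $$\mathbb{P}_n(m)=\Pr\big[\,t_1\text{ is sent before }t_2\ \big|\ E\,\big]=\int_{0}^{\infty}\left(\frac{\Pr[E\mid\omega]\cdot p(\omega)}{\int_{-\infty}^{\infty}\Pr[E\mid\widehat{\omega}]\cdot p(\widehat{\omega})\,d\widehat{\omega}}\right)d\omega .$$
   Context: For a transaction $t$, $\sigma(t)$ denotes the time at which $t$ is sent. The sending time difference $W=\sigma(t_2)-\sigma(t_1)$ is a real-valued random variable with probability density function $p$ on $\mathbb{R}$ (the paper writes $\Pr[\omega]$ for $p(\omega)$). The event that $t_1$ is sent before $t_2$ is $\{W>0\}$. For an observer $o\in\mathcal{O}$, the propagation time $\tau_o(t)$ is a nonnegative real random variable: the time it takes to deliver $t$ from its sender to $o$. Observer $o$ receives $t$ at time $\sigma(t)+\tau_o(t)$, so ''$o$ receives $t_1$ before $t_2$'' is the event $\tau_o(t_1)<W+\tau_o(t_2)$, and $$E=\Big\{\,m=\big|\{o\in\mathcal{O}\ :\ \tau_o(t_1)<W+\tau_o(t_2)\}\big|\,\Big\}.$$ Standing assumptions: all propagation times $\tau_o(t)$ (for $o\in\mathcal{O}$, $t\in\{t_1,t_2\}$) follow one common distribution $\mathcal{D}^{(r)}$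 on $[0,\infty)$ having a probability density function; they are mutually independent and independent of $W$. For $\omega\in\mathbb{R}$, $\Pr[E\mid\omega]$ denotes the probability of $E$ given $W=\omega$, i.e. the probability that exactly $m$ of the $n$ observers $o$ satisfy $\tau_o(t_1)<\omega+\tau_o(t_2)$. *)

(* Defs.v *)
From HB Require Import structures.
From mathcomp Require Import all_boot all_order all_algebra.
From mathcomp Require Import all_classical all_reals all_analysis.

Set Implicit Arguments.
Unset Strict Implicit.
Unset Printing Implicit Defensive.

Import Order.TTheory GRing.Theory Num.Theory.
Import numFieldNormedType.Exports.

Local Open Scope classical_set_scope.
Local Open Scope ring_scope.
Local Open Scope ereal_scope.

Definition cond_prob d (T : measurableType d) (R : realType)
    (P : probability T R) (A B : set T) : \bar R :=
  P (A `&` B) / P B.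

Definition is_density (R : realType) (D : probability R R) (f : R -> R) : Prop :=
  [/\ measurable_fun [set: R] f,
      forall x, (0 <= f x)%R &
      forall A : set R, measurable A ->
        D A = \int[lebesgue_measure]_(x in A) (f x)%:E].

Definition has_law d (T : measurableType d) (R : realType)
    (P : probability T R) (X : {RV P >-> R}) (D : probability R R) : Prop :=
  forall A : set R, measurable A -> distribution P X A = D A.

(* Product rule over every subfamily [J] of a finite family. *)
Definition mutually_independent d (T : measurableType d) (R : realType)
    (P : probability T R) (I : finType) (X : I -> {RV P >-> R}) : Prop :=
  forall (J : {set I}) (A : I -> set R),
    (forall i, i \in J -> measurable (A i)) ->
    P (\bigcap_(i in [set i | i \in J]) (X i @^-1` A i)) =
    \prod_(i in J) P (X i @^-1` A i).

Section observers.
Context d (T : measurableType d) (R : realType) (P : probability T R).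
Context (Tx : Type) (O : finType).
Context (W : {RV P >-> R}) (tau : O -> Tx -> {RV P >-> R}) (t1 t2 : Tx).

(* [None] indexes the sending time difference, [Some (o, b)] the propagation
   time to [o] of [t1] (if [b]) or [t2] (otherwise); mutual independence of this
   family says that the propagation times are mutually independent and that
   they are jointly independent of [W]. *)
Definition random_inputs (i : option (O * bool)) : {RV P >-> R} :=
  if i is Some (o, b) then tau o (if b then t1 else t2) else W.

(* [num_first w x] counts the observers receiving [t1] before [t2] in the
   outcome [x] when [t2] is sent [w] after [t1]. *)
Definition num_first (w : R) (x : T) : nat :=
  #|[pred o : O | (tau o t1 x < w + tau o t2 x)%R]|.

Definition sent_before : set T := [set x | (0 < W x)%R].

Definition received_event (m : nat) : set T := [set x | m = num_first (W x) x].

(* The conditional probability of [received_event m] given [W = w]: only the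
   propagation times are random, [W] being frozen to the value [w]. *)
Definition prob_received_given (m : nat) (w : R) : \bar R :=
  P [set x | m = num_first w x].

End observers.

(* Main.v *)
Require Import Defs.
From HB Require Import structures.
From mathcomp Require Import all_boot all_order all_algebra.
From mathcomp Require Import all_classical all_reals all_analysis.
From mathcomp Require Import measurable_realfun.

(* W is independent of the sigma-algebra generated by the propagation times, so
   the joint law of W and these times is a product measure. Computing the
   probability of {W in B} and E by slicing this product along W gives the
   integral over B of Pr[E | w] against the law of W, that is, of
   Pr[E | w] p(w) dw. Taking B = ]0, +oo[ gives the numerator of the
   conditional probability, and B = R its denominator. *)

Set Implicit Arguments.
Unset Strict Implicit.
Unset Printing Implicit Defensive.

Import Order.TTheory GRing.Theory Num.Theory.
Import numFieldNormedType.Exports.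

Local Open Scope classical_set_scope.
Local Open Scope ring_scope.
Local Open Scope ereal_scope.

(** [p] and the Radon-Nikodym derivative of [nu] have the same integral over every measurable subset
    of [B], so they agree almost everywhere there. The change of variables for the derivative thus
    passes to [p]. *)
Lemma integral_density d (T : measurableType d) (R : realType)
    (mu : {sigma_finite_measure set T -> \bar R})
    (nu : {finite_measure set T -> \bar R}) (p : T -> R)
    (f : T -> \bar R) (B : set T) :
  measurable_fun setT p ->
  (forall A, measurable A -> nu A = \int[mu]_(x in A) (p x)%:E) ->
  measurable B -> nu.-integrable B f ->
  \int[nu]_(x in B) f x = \int[mu]_(x in B) (f x * (p x)%:E).
Proof.
move=> mp nup mB intf.
have mpE A : measurable_fun A (fun x => (p x)%:E).
  by apply: measurable_funTS; exact/measurable_EFinP.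
have numu : nu `<< mu.
  apply/null_content_dominatesP => A mA A0; rewrite nup//.
  exact: null_set_integral.
rewrite -(Radon_Nikodym_change_of_variables numu)//.
have mRN : measurable_fun B (Radon_Nikodym (charge_of_finite_measure nu) mu).
  apply: measurable_funTS; apply: measurable_int.
  exact: Radon_Nikodym_integrable.
have mf := measurable_int _ intf.
apply: ae_eq_integral => //; try exact: emeasurable_funM.
apply: ae_eqe_mul2l; apply: integral_ae_eq => //.
  by apply: (integrableS measurableT) => //; exact: Radon_Nikodym_integrable.
by move=> A AB mA; rewrite -nup// -Radon_Nikodym_integral.
Qed.

(* [R] and [measurableTypeR R], the domain of [lebesgue_measure], have the same
   measurable sets but different displays: [D] is transported along [id]. *)
Lemma ge0_integral_density_lebesgue (R : realType) (D : probability R R)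
    (p : R -> R) (f : R -> \bar R) (B : set R) :
  is_density D p -> measurable B -> (forall x, 0 <= f x) -> D.-integrable B f ->
  \int[D]_(x in B) f x = \int[lebesgue_measure]_(x in B) (f x * (p x)%:E).
Proof.
move=> [mp _ Dp] mB f0 intf.
have mid : @measurable_fun _ _ R (measurableTypeR R) setT id.
  by move=> _ A mA; rewrite setTI.
pose idR := @mfun_Sub _ _ R (measurableTypeR R) id (mem_set mid).
have mf := measurable_int _ intf.
have intE h : measurable_fun B h -> (forall x, 0 <= h x) ->
    \int[distribution D idR]_(x in B) h x = \int[D]_(x in B) h x.
  by move=> mh h0; rewrite ge0_integral_pushforward.
rewrite -intE//; apply: integral_density => //.
apply/integrableP; split=> //.
rewrite intE//; first by case/integrableP: intf.
exact: measurableT_comp.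
Qed.

(** By independence, the law of [(X, Y)] and the product of the two laws agree on rectangles, hence
    everywhere; a product measure integrates the measures of sections. *)
Lemma prob_independent_pair d d1 d2 (T : measurableType d)
    (U : measurableType d1) (V : measurableType d2) (R : realType)
    (P : probability T R) (X : {RV P >-> U}) (Y : {RV P >-> V})
    (S : set (U * V)) (B : set U) :
  (forall A C, measurable A -> measurable C ->
    P (X @^-1` A `&` Y @^-1` C) = P (X @^-1` A) * P (Y @^-1` C)) ->
  measurable S -> measurable B ->
  P (X @^-1` B `&` [set x | S (X x, Y x)]) =
  \int[distribution P X]_(u in B) P [set x | S (u, Y x)].
Proof.
move=> XY mS mB.
have mXY : measurable_fun setT (fun x => (X x, Y x)) by exact: measurable_fun_pair.
pose XYm : {mfun T >-> (U * V)%type} := mfun_Sub (mem_set mXY).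
have := @product_measure_unique _ _ _ _ _ (distribution P X) (distribution P Y)
  (distribution P XYm) XY ((B `*` setT) `&` S).
rewrite /product_measure1 => /(_ _)/esym E.
rewrite [RHS]integral_mkcond.
transitivity (distribution P XYm ((B `*` setT) `&` S)).
  rewrite /distribution /pushforward/=; congr (P _).
  by apply/seteqP; split => x /=; [case|case=> -[]].
rewrite E; last by apply: measurableI => //; exact: measurableX.
apply: eq_integral => u _; rewrite patchE /distribution /pushforward /=.
(* The section at [u] is that of [S] when [u] lies in [B] and empty otherwise, matching the
   integrand extended by zero. *)
case: ifPn => [/set_mem uB|/negP uB].
  by congr (P _); apply/seteqP; split => x; rewrite /xsection /= inE; [case|].
rewrite (_ : xsection _ _ = set0) ?measure0//.
by apply/seteqP; split => x //; rewrite /xsection /= inE => -[[/mem_set/uB]].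
Qed.

Section observers_theory.
Context d (T : measurableType d) (R : realType) (P : probability T R).
Context (Tx : Type) (O : finType).
Context (W : {RV P >-> R}) (tau : O -> Tx -> {RV P >-> R}) (t1 t2 : Tx).
Hypothesis indep : mutually_independent (random_inputs W tau t1 t2).

Definition propagation (i : O * bool) : {RV P >-> R} :=
  tau i.1 (if i.2 then t1 else t2).

(** All coordinates are constrained at once, a free one by [setT], so that the boxes form a
    pi-system. *)
Definition propagation_boxes : set (set T) :=
  [set C | exists2 A : O * bool -> set R, forall i, measurable (A i) &
    C = \bigcap_i (propagation i @^-1` A i)].

(* [T] itself with the coarser sigma-algebra generated by the propagation times:
   it plays the role of the space of all vectors of propagation times. *)
Definition propagation_space := g_sigma_algebraType propagation_boxes.

Lemma propagation_boxes_setI : setI_closed propagation_boxes.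
Proof.
move=> _ _ [A mA ->] [B mB ->]; exists (fun i => A i `&` B i).
  by move=> i; exact: measurableI.
by rewrite -bigcapI; apply: eq_bigcapr => i _; rewrite preimage_setI.
Qed.

Lemma propagation_boxes_setT : propagation_boxes setT.
Proof.
by exists (fun=> setT) => //; apply/seteqP; split.
Qed.

Lemma measurable_box (A : O * bool -> set R) :
  (forall i, measurable (A i)) ->
  measurable (\bigcap_i (propagation i @^-1` A i) : set T).
Proof.
move=> mA; apply: fin_bigcap_measurable => // i _.
exact: measurable_funPTI.
Qed.

Lemma measurable_propagation i :
  measurable_fun setT (propagation i : propagation_space -> R).
Proof.
move=> _ A mA; rewrite setTI; apply: sub_sigma_algebra.
exists (fun j => if j == i then A else setT) => [j|]; first by case: ifP.
apply/seteqP; split => [x Ax j _ /=|x /(_ i Logic.I)]; last by rewrite /= eqxx.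
by case: eqP => // ->.
Qed.

Lemma measurable_propagation_space :
  measurable_fun setT (id : T -> propagation_space).
Proof.
apply: (@measurability _ _ T propagation_space setT id propagation_boxes) => //.
by move=> _ [_ [A mA ->] <-]; rewrite setTI; exact: measurable_box.
Qed.

Definition to_propagation_space : {mfun T >-> propagation_space} :=
  mfun_Sub (mem_set measurable_propagation_space).

(** The product rule is used twice: over the full family, where the factor at [None] is split off,
    and over the family without [None], where the remaining factors recombine into [P C]. *)
Lemma prob_box A C : measurable A -> propagation_boxes C ->
  P (W @^-1` A `&` C) = P (W @^-1` A) * P C.
Proof.
move=> mA [B mB ->].
pose F i := if i is Some j then B j else A.
have mF i : measurable (F i) by case: i.
have bigcapE : \bigcap_(i in [set i | i \in [set~ None]%SET])
    (random_inputs W tau t1 t2 i @^-1` F i) =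
    \bigcap_i (propagation i @^-1` B i).
  apply/seteqP; split => x Bx.
    by move=> [k b] _; apply: (Bx (Some (k, b))); rewrite /= !inE.
  by move=> [[k b]|] /=; [move=> _; exact: (Bx (k, b))|rewrite !inE].
have indepF J := @indep J F (fun i _ => mF i).
have := indepF [set: _]%SET.
rewrite (big_setD1 None)//= finset.setTD -bigcapE indepF => <-.
congr (P _); rewrite bigcapE; apply/seteqP; split => x.
  by move=> [Ax Bx] [[k b]|] _ //; exact: (Bx (k, b)).
move=> Fx; split; first by apply: (Fx None); rewrite /= inE.
by move=> [k b] _; apply: (Fx (Some (k, b))); rewrite /= inE.
Qed.

(** As functions of [C], both sides are finite measures, [P] restricted to an event and [P] scaled
    by a constant. They agree on the pi-system of boxes, hence on the sigma-algebra it generates. *)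
Lemma independent_propagation A (C : set T) :
  measurable A -> <<s propagation_boxes >> C ->
  P (W @^-1` A `&` C) = P (W @^-1` A) * P C.
Proof.
move=> mA sC.
have mWA : measurable (W @^-1` A).
  exact: measurable_funPTI.
have r0 : (0 <= fine (P (W @^-1` A)))%R by exact: fine_ge0.
rewrite setIC -[P (W @^-1` A)]fineK ?fin_num_measure//.
apply: (@g_sigma_algebra_measure_unique _ _ _ propagation_boxes _ (fun=> setT) _ _
  (mrestr P mWA) (mscale (NngNum r0) P)) => //.
- by move=> _ [B mB ->]; exact: measurable_box.
- by move=> _; exact: propagation_boxes_setT.
- by rewrite bigcup_const.
- exact: propagation_boxes_setI.
- move=> B boxB; transitivity (P (W @^-1` A) * P B).
    by rewrite -prob_box// setIC.
  by rewrite -{1}[P (W @^-1` A)]fineK// fin_num_measure.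
- by move=> _; apply: fin_num_fun_lty; exact: fin_num_measure.
Qed.

(** The count is a finite sum of indicators of comparisons between jointly measurable functions of
    [w] and the propagation times. *)
Lemma measurable_num_first m :
  measurable [set wx : R * propagation_space | m = num_first tau t1 t2 wx.1 wx.2].
Proof.
have sumE w x : (num_first tau t1 t2 w x)%:R =
    (\sum_o if (tau o t1 x < w + tau o t2 x)%R then 1 else 0 : R)%R.
  by rewrite /num_first -sum1_card natr_sum big_mkcond.
have mS : measurable_fun setT (fun wx : R * propagation_space =>
    (num_first tau t1 t2 wx.1 wx.2)%:R : R).
  under eq_fun do rewrite sumE.
  apply: measurable_sum => o; apply: measurable_fun_ifT => //.
  have mtau b : measurable_fun setT
      (fun wx : R * propagation_space => tau o (if b then t1 else t2) wx.2).
    exact: (measurableT_comp (measurable_propagation (o, b)) measurable_snd).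
  apply: measurable_fun_ltr; first exact: (mtau true).
  by apply: measurable_funD => //; exact: (mtau false).
rewrite [X in measurable X](_ : _ = [set: _] `&`
   (fun wx : R * propagation_space => (num_first tau t1 t2 wx.1 wx.2)%:R : R)
     @^-1` [set m%:R]).
  exact: mS.
apply/seteqP; split => wx /=; first by move=> ->.
by move=> [_ /eqP]; rewrite eqr_nat => /eqP.
Qed.

Lemma prob_received_event (m : nat) (B : set R) : measurable B ->
  P (W @^-1` B `&` received_event W tau t1 t2 m) =
  \int[distribution P W]_(w in B) prob_received_given tau t1 t2 m w.
Proof.
move=> mB.
apply: (@prob_independent_pair _ _ _ _ _ _ _ P W to_propagation_space _ _ _
  (measurable_num_first m) mB).
by move=> A C mA mC; exact: independent_propagation.
Qed.

(** Seen as the measure of a section, this probability is measurable in [w]. *)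
Lemma prob_received_givenE (m : nat) (w : R) : prob_received_given tau t1 t2 m w =
  distribution P to_propagation_space
    (xsection [set wx | m = num_first tau t1 t2 wx.1 wx.2] w).
Proof.
by congr (P _); apply/seteqP; split => x; rewrite /xsection /= inE.
Qed.

Lemma measurable_prob_received_given (m : nat) :
  measurable_fun setT (prob_received_given tau t1 t2 m).
Proof.
rewrite (funext (prob_received_givenE m)).
exact: measurable_fun_xsection (measurable_num_first m).
Qed.

Lemma prob_received_given_le1 (m : nat) (w : R) :
  prob_received_given tau t1 t2 m w <= 1.
Proof.
rewrite prob_received_givenE; apply: probability_le1.
exact: measurable_xsection (measurable_num_first m).
Qed.

End observers_theory.

Theorem theorem2 (R : realType) (d : measure_display) (T : measurableType d)
    (P : probability T R)
    (Tx : Type) (t1 t2 : Tx)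
    (O : finType) (n : nat) (hn : #|O| = n)
    (m : nat) (hm : (m <= n)%N)
    (sigma : Tx -> T -> R)
    (W : {RV P >-> R}) (hW : forall x, W x = (sigma t2 x - sigma t1 x)%R)
    (p : R -> R) (hp : is_density (distribution P W) p)
    (tau : O -> Tx -> {RV P >-> R})
    (tau_ge0 : forall o t x, (0 <= tau o t x)%R)
    (D : probability R R) (D_ge0 : D `[0%R, +oo[%classic = 1)
    (D_density : exists f : R -> R, is_density D f)
    (tau_law : forall o t, t = t1 \/ t = t2 -> has_law (tau o t) D)
    (indep : mutually_independent (random_inputs W tau t1 t2))
    (hE : 0 < P (received_event W tau t1 t2 m)) :
  cond_prob P (sent_before W) (received_event W tau t1 t2 m) =
  \int[lebesgue_measure]_(w in `[0%R, +oo[)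
    (prob_received_given tau t1 t2 m w * (p w)%:E /
     \int[lebesgue_measure]_(w' in [set: R])
       (prob_received_given tau t1 t2 m w' * (p w')%:E)).
Proof.
set E := received_event W tau t1 t2 m in hE *.
set g := prob_received_given tau t1 t2 m.
have [mp p0 Wp] := hp.
have mg (B : set R) : measurable_fun B g.
  apply: measurable_funTS; exact: measurable_prob_received_given.
have g0 w : 0 <= g w by exact: measure_ge0.
have mgp (B : set R) : measurable_fun B (fun w => g w * (p w)%:E).
  apply: emeasurable_funM => //.
  by apply: measurable_funTS; exact/measurable_EFinP.
have PWE (B : set R) : measurable B ->
    P (W @^-1` B `&` E) = \int[lebesgue_measure]_(w in B) (g w * (p w)%:E).
  move=> mB; rewrite /E prob_received_event//.
  apply: ge0_integral_density_lebesgue => //.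
  (* [g] is bounded by 1, hence integrable for the law of [W]. *)
  apply: (le_integrable _ _ _ (finite_measure_integrable_cst _ 1%R _)) => //.
  move=> w _ /=; rewrite gee0_abs// normr1.
  exact: prob_received_given_le1.
(* With [B] the whole line, the denominator becomes [P E], a constant that leaves the outer
   integral. *)
rewrite -/g -PWE// preimage_setT setTI.
rewrite ge0_integralZr//.
- rewrite /cond_prob; congr (_ / _).
  (* Dropping the endpoint 0, a Lebesgue null set, turns the domain into the strict condition of
     [sent_before]. *)
  rewrite -integral_itv_obnd_cbnd// -PWE//; congr (P (_ `&` _)).
  by apply/seteqP; split => x; rewrite /sent_before /= in_itv/= andbT.
- exact: mgp.
- by move=> w _; apply: mule_ge0 => //; rewrite lee_fin.
- by rewrite inve_ge0.
Qed.
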